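(* Let $k$ be a field, $A=k[t_0,\dots,t_n]$, and for each $i\in\{0,\dots,n\}$ let $f_i,g_i\in A$ be homogeneous of the same degree $d_i$. If the sequence $\{f_i,g_i\}$ is regular for every $i\in\{0,\dots,n\}$, then there is an isomorphism of $A$-complexes $$\mathscr{Z}_\bullet\cong\mathcal{K}_\bullet,$$ where $\mathscr{Z}_\bullet:=\bigotimes_{i=0}^n\mathscr{Z}_\bullet(f_i,g_i)$ (tensor product over $A$ of the approximation complexes of cycles) and $\mathcal{K}_\bullet:=\mathcal{K}_\bullet(L_0,\dots,L_n;A[x_0,y_0,\dots,x_n,y_n])$ is the Koszul complex of the polynomials $L_i:=f_iy_i-g_ix_i$.
   Context: For homogeneous $f,g\in A$ of degree $d$, the approximation complex of cycles $\mathscr{Z}_\bullet(f,g)$ over $A[x,y]$ is the complex $$0\to Z_1[d]\otimes_AA[x,y](-1)\xrightarrow{(x,y)}A[x,y]\to0,$$ where $Z_1=\{(a,b)\in A^2: af+bg=0\}$ is the module of 1-cycles of the Koszul complex $\mathcal{K}_\bullet(f,g;A)$, the differential sends $(a,b)\otimes h$ to $(ax+by)h$, $[\cdot]$ is the degree shift for the grading on $A$ and $(\cdot)$ the shift in the variables $x,y$. The complex $\mathscr{Z}_\bullet(f_i,g_i)$ uses variables $x_i,y_i$ in place of $x,y$. *)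

(* Defs.v *)
From HB Require Import structures.
From mathcomp Require Import all_boot all_order all_algebra generic_quotient ring_quotient.
From mathcomp Require Import ring.
From mathcomp Require Import boolp ssrcomplements freeg mpoly.

Set Implicit Arguments.
Unset Strict Implicit.
Unset Printing Implicit Defensive.

Import GRing.Theory.
Local Open Scope ring_scope.
Local Open Scope quotient_scope.

(* Quotient of a module by the submodule spanned by [rel].                    *)
Section QuotientModule.
Variables (R : comNzRingType) (M : lmodType R) (rel : M -> Prop).

Definition mspan : {pred M} := fun x =>
  `[< forall S : submodClosed M, (forall y, rel y -> y \in S) -> x \in S >].

Lemma mspan_submod : submod_closed mspan.
Proof.
split=> [|a x y /asboolP xP /asboolP yP]; apply/asboolP=> S relS.
  exact: rpred0.
by rewrite rpredD ?rpredZ ?xP ?yP.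
Qed.
HB.instance Definition _ := GRing.isSubmodClosed.Build R M mspan mspan_submod.

Lemma mspan_rel x : rel x -> x \in mspan.
Proof. by move=> xr; apply/asboolP=> S; apply. Qed.

Lemma mspan_min (S : {pred M}) :
  submod_closed S -> (forall y, rel y -> y \in S) -> {subset mspan <= S}.
Proof.
move=> clS relS x /asboolP.
by move=> /(_ (HB.pack_for (submodClosed M) (S : M -> bool)
                 (GRing.isSubmodClosed.Build R M S clS))); apply.
Qed.

Definition mquot : Type := Quotient.quot mspan.
HB.instance Definition _ := GRing.Zmodule.on mquot.

Definition mproj (x : M) : mquot := \pi_(Quotient.quot mspan) x.
Definition mrepr (x : mquot) : M := repr (x : Quotient.quot mspan).

Lemma mreprK : cancel mrepr mproj. Proof. exact: reprK. Qed.

Lemma mprojP x y : (mproj x = mproj y) <-> (x - y \in mspan).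
Proof.
rewrite Quotient.idealrBE; split=> [e|/eqP//]; exact/eqP.
Qed.

Lemma mprojD x y : mproj (x + y) = mproj x + mproj y.
Proof. exact: (raddfD (\pi_(Quotient.quot mspan))). Qed.

Definition mscale a (x : mquot) : mquot := mproj (a *: mrepr x).

Lemma mprojZ a x : mproj (a *: x) = mscale a (mproj x).
Proof.
by apply/mprojP; rewrite -scalerBr rpredZ //; apply/mprojP; rewrite mreprK.
Qed.

Fact mscaleA a b x : mscale a (mscale b x) = mscale (a * b) x.
Proof. by rewrite -[x]mreprK -!mprojZ scalerA. Qed.
Fact mscale1 : left_id 1 mscale.
Proof. by move=> x; rewrite -[x]mreprK -mprojZ scale1r. Qed.
Fact mscaleDr : right_distributive mscale +%R.
Proof.
move=> a x y; rewrite -[x]mreprK -[y]mreprK.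
by rewrite -mprojD -!mprojZ scalerDr mprojD.
Qed.
Fact mscaleDl x : {morph mscale^~ x : a b / a + b}.
Proof.
by move=> a b; rewrite -[x]mreprK -!mprojZ scalerDl mprojD.
Qed.
HB.instance Definition _ := GRing.Zmodule_isLmodule.Build R mquot
  mscaleA mscale1 mscaleDr mscaleDl.

Fact mproj_linear : linear mproj.
Proof. by move=> a x y; rewrite mprojD mprojZ. Qed.
HB.instance Definition _ := GRing.isLinear.Build R M mquot _ mproj mproj_linear.

End QuotientModule.

(* The free module on [K].  [fglift] is only declared additive in the library. *)
Section FreeModule.
Variables (R : comNzRingType) (K : choiceType).

Definition freemod : Type := {freeg K / R}.
HB.instance Definition _ := GRing.Lmodule.on freemod.

Definition fgen (x : K) : freemod := << x >>.

Lemma freemodE (t : freemod) : t = \sum_(x <- dom t) coeff x t *: fgen x.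
Proof.
rewrite -[LHS]freeg_sumE; apply: eq_bigr => x _; apply/eqP/freeg_eqP=> y.
by rewrite coeffZ !coeffU mul1r.
Qed.

Section Lift.
Variables (N : lmodType R) (F : K -> N).

Definition flift (t : freemod) : N := fglift F t.

Lemma flift_gen x : flift (fgen x) = F x.
Proof. by rewrite /flift /fgen liftU scale1r. Qed.

Fact flift_zmod : zmod_morphism flift.
Proof. exact: lift_is_additive. Qed.
HB.instance Definition _ := GRing.isZmodMorphism.Build freemod N flift flift_zmod.

Fact flift_scalable : scalable flift.
Proof.
have U c x : flift (c *: fgen x) = c *: F x.
  have -> : c *: fgen x = << c *g x >> :> freemod.
    by apply/eqP/freeg_eqP=> y; rewrite coeffZ !coeffU mul1r.
  exact: liftU.
move=> a t; rewrite [t in LHS]freemodE [t in RHS]freemodE.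
rewrite scaler_sumr raddf_sum [in RHS]raddf_sum scaler_sumr /=.
apply: eq_bigr => x _ /=.
by rewrite scalerA !U scalerA.
Qed.
HB.instance Definition _ := GRing.isScalable.Build R freemod N *:%R flift flift_scalable.
End Lift.
End FreeModule.

Section Tensor.
Variables (R : comNzRingType) (I : eqType) (M : I -> lmodType R).

Definition multilinear (N : lmodType R) (F : (forall i, M i) -> N) :=
  forall (x : forall i, M i) i a (u v : M i),
    F (dfwith x (a *: u + v)) = a *: F (dfwith x u) + F (dfwith x v).

Definition tfree := freemod R {classic (forall i, M i)}.
Definition tgen (x : forall i, M i) : tfree := fgen R (x : {classic (forall i, M i)}).

Definition trel (t : tfree) :=
  exists (x : forall i, M i) i a (u v : M i),
    t = tgen (dfwith x (a *: u + v)) - (a *: tgen (dfwith x u) + tgen (dfwith x v)).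

Definition tens : Type := mquot trel.
HB.instance Definition _ := GRing.Lmodule.on tens.

Definition pure (x : forall i, M i) : tens := mproj trel (tgen x).

Lemma pure_multilinear : multilinear pure.
Proof.
move=> x i a u v; rewrite /pure -linearP; apply/mprojP/mspan_rel.
by exists x, i, a, u, v.
Qed.

Section Lift.
Variables (N : lmodType R) (F : (forall i, M i) -> N).

Definition tlift of multilinear F := fun t : tens =>
  flift (F : {classic (forall i, M i)} -> N) (mrepr t).

Variable mF : multilinear F.

Fact tlift_proj t : tlift mF (mproj trel t) =
  flift (F : {classic (forall i, M i)} -> N) t.
Proof.
pose f : {linear tfree -> N} := flift (F : {classic (forall i, M i)} -> N).
pose S : {pred tfree} := [pred t | f t == 0].
have clS : submod_closed S.
  split=> [|a u v]; rewrite !inE /=; first by rewrite linear0.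
  by move=> /eqP u0 /eqP v0; rewrite linearP /= u0 v0 scaler0 addr0.
have relS y : trel y -> y \in S.
  case=> x [i] [a] [u] [v] ->; rewrite inE /= linearB /=.
  by rewrite linearD !flift_gen linearZ /= !flift_gen mF subrr.
have /mprojP/(mspan_min clS relS) : mproj trel (mrepr (mproj trel t)) = mproj trel t.
  exact: mreprK.
by rewrite inE /= linearB subr_eq0 => /eqP.
Qed.

Fact tlift_linear : linear (tlift mF).
Proof.
move=> a x y; rewrite -[x]mreprK -[y]mreprK -linearP !tlift_proj.
exact: linearP.
Qed.
HB.instance Definition _ := GRing.isLinear.Build R tens N _ (tlift mF) tlift_linear.

Lemma tlift_pure x : tlift mF (pure x) = F x.
Proof. by rewrite tlift_proj flift_gen. Qed.
End Lift.

Lemma tens_ind (N : lmodType R) (f g : {linear tens -> N}) :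
  (forall x, f (pure x) = g (pure x)) -> f =1 g.
Proof.
move=> fg t; rewrite -[t]mreprK [mrepr t]freemodE !raddf_sum.
apply: eq_bigr => x _ /=. by rewrite !linearZ /= -/(pure x) fg.
Qed.
End Tensor.

Section TensorMap.
Variables (R : comNzRingType) (I : eqType) (M N : I -> lmodType R).
Variable phi : forall i, {linear M i -> N i}.

Fact tmap_multilinear : multilinear (fun x : forall i, M i => pure (fun i => phi i (x i))).
Proof.
have E x i (u : M i) : (fun j => phi j (dfwith x u j))
    = dfwith (fun j => phi j (x j)) (phi i u).
  apply: functional_extensionality_dep => j; case: (eqVneq i j) => [e|ne].
    by case: _ / e; rewrite !dfwith_in.
  by rewrite !dfwith_out.
by move=> x i a u v; rewrite !E linearP pure_multilinear.
Qed.
Definition tmap : {linear tens M -> tens N} := tlift tmap_multilinear.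
End TensorMap.

Section TensorMapTheory.
Variables (R : comNzRingType) (I : eqType).

Lemma tmap_pure (M N : I -> lmodType R) (phi : forall i, {linear M i -> N i}) x :
  tmap phi (pure x) = pure (fun i => phi i (x i)).
Proof. exact: tlift_pure. Qed.

Lemma pure_eq0 (M : I -> lmodType R) (x : forall i, M i) i : x i = 0 -> pure x = 0.
Proof.
move=> xi0; have -> : x = dfwith x (0 : M i).
  apply: functional_extensionality_dep => j; case: (eqVneq i j) => [e|ne].
    by case: _ / e; rewrite dfwith_in.
  by rewrite dfwith_out.
have := pure_multilinear x (-1) (0 : M i) 0.
by rewrite scaler0 addr0 scaleN1r addNr.
Qed.

Lemma tmap_eq0 (M N : I -> lmodType R) (phi : forall i, {linear M i -> N i}) i t :
  (forall x, phi i x = 0) -> tmap phi t = 0.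
Proof.
move=> phi0; apply: (@tens_ind _ _ _ _ (tmap phi) \0) => x.
by rewrite tmap_pure; apply: (@pure_eq0 _ _ i).
Qed.

Lemma tmap_comp (M N P : I -> lmodType R) (psi : forall i, {linear N i -> P i})
    (phi : forall i, {linear M i -> N i}) (chi : forall i, {linear M i -> P i}) t :
  (forall i x, psi i (phi i x) = chi i x) -> tmap psi (tmap phi t) = tmap chi t.
Proof.
move=> E; apply: (@tens_ind _ _ _ _ (tmap psi \o tmap phi) (tmap chi)) => x /=.
rewrite !tmap_pure; congr pure; apply: functional_extensionality_dep => i; exact: E.
Qed.

Lemma tmap_comp0 (M N P : I -> lmodType R) (psi : forall i, {linear N i -> P i})
    (phi : forall i, {linear M i -> N i}) i t :
  (forall x, psi i (phi i x) = 0) -> tmap psi (tmap phi t) = 0.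
Proof.
move=> E; apply: (@tens_ind _ _ _ _ (tmap psi \o tmap phi) \0) => x /=.
by rewrite !tmap_pure; apply: (@pure_eq0 _ _ i).
Qed.
End TensorMapTheory.

Section DirectSum.
Variables (R : comNzRingType) (I : finType) (M : I -> lmodType R).
Implicit Types x y : {dffun forall i, M i}.

Definition dsum_zero : {dffun forall i, M i} := [ffun i => 0].
Definition dsum_opp x : {dffun forall i, M i} := [ffun i => - x i].
Definition dsum_add x y : {dffun forall i, M i} := [ffun i => x i + y i].
Definition dsum_scale a x : {dffun forall i, M i} := [ffun i => a *: x i].

Fact dsum_addA : associative dsum_add.
Proof. by move=> x y z; apply/ffunP => i; rewrite !ffunE addrA. Qed.
Fact dsum_addC : commutative dsum_add.
Proof. by move=> x y; apply/ffunP => i; rewrite !ffunE addrC. Qed.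
Fact dsum_add0 : left_id dsum_zero dsum_add.
Proof. by move=> x; apply/ffunP => i; rewrite !ffunE add0r. Qed.
Fact dsum_addN : left_inverse dsum_zero dsum_opp dsum_add.
Proof. by move=> x; apply/ffunP => i; rewrite !ffunE addNr. Qed.
HB.instance Definition _ := GRing.isZmodule.Build {dffun forall i, M i}
  dsum_addA dsum_addC dsum_add0 dsum_addN.

Fact dsum_scaleA a b x : dsum_scale a (dsum_scale b x) = dsum_scale (a * b) x.
Proof. by apply/ffunP => i; rewrite !ffunE scalerA. Qed.
Fact dsum_scale1 : left_id 1 dsum_scale.
Proof. by move=> x; apply/ffunP => i; rewrite !ffunE scale1r. Qed.
Fact dsum_scaleDr : right_distributive dsum_scale +%R.
Proof. by move=> a x y; apply/ffunP => i; rewrite !ffunE scalerDr. Qed.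
Fact dsum_scaleDl x : {morph dsum_scale^~ x : a b / a + b}.
Proof. by move=> a b; apply/ffunP => i; rewrite !ffunE scalerDl. Qed.
HB.instance Definition _ := GRing.Zmodule_isLmodule.Build R {dffun forall i, M i}
  dsum_scaleA dsum_scale1 dsum_scaleDr dsum_scaleDl.
End DirectSum.

Lemma sum_antisym (V : zmodType) m (t : 'I_m -> 'I_m -> V) :
    (forall i, t i i = 0) -> (forall i k, i != k -> t i k = - t k i) ->
  \sum_i \sum_k t i k = 0.
Proof.
move=> t0 tN; have E i : \sum_k t i k =
    \sum_(k < m | (k < i)%N) t i k + \sum_(k < m | (i < k)%N) t i k.
  rewrite (bigID (fun k : 'I_m => (k < i)%N)) /=; congr (_ + _).
  rewrite (bigD1 i) ?ltnn //= t0 add0r; apply: eq_bigl => k.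
  by rewrite -leqNgt ltn_neqAle eq_sym andbC.
rewrite (eq_bigr _ (fun i _ => E i)) big_split /=.
rewrite [X in _ + X](exchange_big_dep predT) //= -big_split big1 //= => i _.
rewrite -big_split big1 //= => k ki.
by rewrite tN ?addNr // eq_sym -val_eqE neq_ltn ki.
Qed.

(* Only the homogeneous components are recorded; the instances below are the  *)
(* usual gradings, for which they do decompose the module.                    *)
Record gmod (R : comNzRingType) (G : zmodType) := GMod {
  gcar :> lmodType R;
  ghom : G -> gcar -> Prop
}.

Section Graded.
Variables (R : comNzRingType) (G : zmodType).
Local Notation gmod := (gmod R G).

Definition gshift (M : gmod) (s : G) : gmod :=
  @GMod R G M (fun u x => ghom (u + s) x).

Definition gzero : gmod := @GMod R G 'rV[R]_0 (fun _ _ => True).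

Definition gdsum (I : finType) (M : I -> gmod) : gmod :=
  @GMod R G {dffun forall i, M i} (fun u x => forall i, ghom u (x i)).

(* A homogeneous element of degree [u] is a sum of pure tensors of homogeneous*)
(* elements whose degrees add up to [u] ([I] is meant to be nonempty).        *)
Definition gtens (I : finType) (M : I -> gmod) : gmod :=
  @GMod R G (tens (fun i => M i)) (fun u t =>
    exists r (x : 'I_r -> forall i, M i) (w : 'I_r -> I -> G),
      [/\ forall l i, ghom (w l i) (x l i),
          forall l, \sum_i w l i = u
        & t = \sum_(l < r) pure (x l)]).

Definition gpair (M N : gmod) (b : bool) : gmod := if b then N else M.
Definition gtens2 (M N : gmod) : gmod := gtens (gpair M N).

Record complex := Complex {
  cobj :> nat -> gmod;
  cdif : forall p, {linear cobj p.+1 -> cobj p};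
  cdif2 : forall p x, cdif p (cdif p.+1 x) = 0
}.

(* [cid C a b] is the identity if [a = b] and [cdiff C a b] is the            *)
(* differential if [a = b + 1]; both are zero otherwise.                      *)
Definition cid (C : complex) a b : {linear C a -> C b} :=
  match a =P b with
  | ReflectT e => ecast c {linear C a -> C c} e idfun
  | _ => \0
  end.
Definition cdiff (C : complex) a b : {linear C a -> C b} :=
  match b.+1 =P a with
  | ReflectT e => ecast c {linear C c -> C b} e (cdif C b)
  | _ => \0
  end.

Lemma cid_id C a b (e : a = b) x : cid C a b x = ecast c (C c) e x.
Proof. by case: _ / e; rewrite /cid; case: eqP => // e; rewrite eq_axiomK. Qed.
Lemma cid0 C a b x : a != b -> cid C a b x = 0.
Proof. by rewrite /cid; case: eqP. Qed.
Lemma cdiffS C a x : cdiff C a.+1 a x = cdif C a x.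
Proof. by rewrite /cdiff; case: eqP => // e; rewrite eq_axiomK. Qed.
Lemma cdiff0 C a b x : a != b.+1 -> cdiff C a b x = 0.
Proof. by rewrite /cdiff eq_sym; case: eqP. Qed.

Lemma cdiff2 C a b c x : cdiff C b c (cdiff C a b x) = 0.
Proof.
have [e|/(cdiff0 _)-> //] := eqVneq b c.+1.
have [e'|/(cdiff0 x)->] := eqVneq a b.+1; last exact: linear0.
by move: x; rewrite e' e => x; rewrite !cdiffS cdif2.
Qed.

Section TensorComplex.
Variables (m : nat) (C : 'I_m -> complex).

(* In homological degree [p], the tensor complex is the direct sum over the   *)
(* multi-indices [v] of sum [p] of the tensor products of the [C j (v j)].    *)
Definition midx p := {v : {ffun 'I_m -> 'I_p.+1} | (\sum_i (v i : nat))%N == p}.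
Definition deg_at p (v : midx p) (i : 'I_m) : nat := val v i.

Definition tobj p : gmod := gdsum (fun v : midx p => gtens (fun j => C j (deg_at v j))).

(* Identity on every factor but the [i]-th one, where it is the differential;*)
(* it vanishes unless [v] is [u] with its [i]-th entry incremented.              *)
Definition tface p q (v : midx p) (u : midx q) (i : 'I_m) :
    {linear tens (fun j => C j (deg_at v j)) -> tens (fun j => C j (deg_at u j))} :=
  tmap (fun j => if j == i then cdiff (C j) (deg_at v j) (deg_at u j) else cid (C j) (deg_at v j) (deg_at u j)).

Definition tdif_fun p (c : tobj p.+1) : tobj p :=
  [ffun u : midx p => \sum_(v : midx p.+1) \sum_(i < m)
     (-1) ^+ (\sum_(j < m | (j < i)%N) deg_at u j) *: tface v u i (c v)].
Local Notation sgn u i := ((-1) ^+ (\sum_(j < m | (j < i)%N) deg_at u j)).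

Fact tdif_linear p : linear (@tdif_fun p).
Proof.
move=> a x y; apply/ffunP => u; rewrite !ffunE scaler_sumr -big_split /=.
apply: eq_bigr => v _; rewrite scaler_sumr -big_split /=; apply: eq_bigr => i _.
by rewrite !ffunE linearP scalerDr !scalerA mulrC.
Qed.
HB.instance Definition _ p := GRing.isLinear.Build R _ _ _ (@tdif_fun p) (@tdif_linear p).

Lemma tface0 p q (v : midx p) (u : midx q) i j t :
  deg_at v j != (deg_at u j + (j == i))%N -> tface v u i t = 0.
Proof.
move=> ne; apply: (tmap_eq0 (i := j)) => x; case: (j =P i) ne => _ /=.
  by rewrite addn1 => /(cdiff0 x).
by rewrite addn0 => /(cid0 x).
Qed.

(* The composite of the faces [i] and [k], up to sign.                        *)
Let tface2 p q (v : midx p) (u : midx q) (i k : 'I_m) :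
    {linear tens (fun j => C j (deg_at v j)) -> tens (fun j => C j (deg_at u j))} :=
  tmap (fun j => if (j == i) || (j == k) then cdiff (C j) (deg_at v j) (deg_at u j)
                 else cid (C j) (deg_at v j) (deg_at u j)).

Lemma tface_comp p q r (v : midx p) (u : midx q) (w : midx r) i k t : i != k ->
    (forall j, deg_at u j = deg_at w j + (j == i))%N ->
    (forall j, deg_at v j = deg_at u j + (j == k))%N ->
  tface u w i (tface v u k t) = tface2 v w i k t.
Proof.
move=> ik uw vu; apply: tmap_comp => j.
move: (deg_at w j) (deg_at u j) (deg_at v j) (uw j) (vu j) => c b a.
case: (eqVneq j i) => [->|ji]; case: (eqVneq _ k) => [jk|jk] /=.
- by rewrite jk eqxx in ik.
- by rewrite addn0 => _ e; case: _ / e => x; rewrite (cid_id (erefl _)).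
- by rewrite addn0 => e; case: _ / e => _ x; rewrite (cid_id (erefl _)).
- by rewrite !addn0 => -> -> x; rewrite !(cid_id (erefl _)).
Qed.

Lemma tdif2 p (c : tobj p.+2) : tdif_fun (tdif_fun c) = 0.
Proof.
apply/ffunP => w; rewrite !ffunE.
pose T (u : midx p.+1) (v : midx p.+2) (i k : 'I_m) := sgn w i *: tface u w i (sgn u k *: tface v u k (c v)).
transitivity (\sum_(v : midx p.+2) \sum_i \sum_k \sum_(u : midx p.+1) T u v i k).
  transitivity (\sum_(u : midx p.+1) \sum_i \sum_(v : midx p.+2) \sum_k T u v i k).
    apply: eq_bigr => u _; apply: eq_bigr => i _.
    rewrite ffunE linear_sum scaler_sumr; apply: eq_bigr => v _.
    by rewrite linear_sum scaler_sumr; apply: eq_bigr.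
  rewrite exchange_big /=; under eq_bigr do rewrite exchange_big /=.
  rewrite exchange_big /=; apply: eq_bigr => v _; apply: eq_bigr => i _.
  by rewrite exchange_big.
rewrite big1 // => v _; apply: sum_antisym => [i|i k ik].
  rewrite big1 // => u _; rewrite /T linearZ /= (tmap_comp0 (i := i)) ?scaler0 //.
  by move=> x; rewrite eqxx cdiff2.
have T0 i0 k0 : ~ (forall j, deg_at v j = deg_at w j + (j == i0) + (j == k0))%N ->
    \sum_(u : midx p.+1) T u v i0 k0 = 0.
  move=> nvw; rewrite big1 // => u _; rewrite /T linearZ /=.
  have [uw|/forallPn[j]] := boolP [forall j, deg_at u j == deg_at w j + (j == i0)]%N;
    last by move/tface0->; rewrite !scaler0.
  have [vu|/forallPn[j]] := boolP [forall j, deg_at v j == deg_at u j + (j == k0)]%N;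
    last by move/tface0->; rewrite linear0 !scaler0.
  by case: nvw => j; rewrite (eqP (forallP vu j)) (eqP (forallP uw j)).
have T1 i0 k0 : i0 != k0 ->
    (forall j, deg_at v j = deg_at w j + (j == i0) + (j == k0))%N ->
    \sum_(u : midx p.+1) T u v i0 k0 =
    (sgn w i0 * sgn w k0 * (-1) ^+ (i0 < k0)%N) *: tface2 v w i0 k0 (c v).
  move=> ik0 vw.
  have ltu j : (deg_at w j + (j == i0) < p.+2)%N.
    by rewrite ltnS -[p.+1]addn1 leq_add ?leq_b1 // -ltnS /deg_at ltn_ord.
  pose u0f : {ffun 'I_m -> 'I_p.+2} := [ffun j => Ordinal (ltu j)].
  have su0 : (\sum_j (u0f j : nat))%N == p.+1.
    under eq_bigr do rewrite ffunE /=.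
    rewrite big_split /= (eqP (valP w)) -addn1 eqn_add2l (bigD1 i0) //= eqxx.
    by rewrite big1 // => j /negbTE->.
  pose u0 : midx p.+1 := exist _ u0f su0.
  have u0E j : deg_at u0 j = (deg_at w j + (j == i0))%N by rewrite /deg_at ffunE.
  rewrite (bigD1 u0) //= big1 ?addr0 => [|u ne]; last first.
    have /forallPn[j] : ~~ [forall j, deg_at u j == deg_at w j + (j == i0)]%N.
      apply: contra ne => /forallP uw; apply/eqP/val_inj/ffunP => j.
      by apply: val_inj; rewrite -[LHS]/(deg_at u j) (eqP (uw j)) -u0E.
    by move/tface0=> t0; rewrite /T linearZ /= t0 !scaler0.
  have vu j : (deg_at v j = deg_at u0 j + (j == k0))%N by rewrite u0E vw.
  rewrite /T linearZ /= (tface_comp _ ik0 u0E vu) scalerA; congr (_ *: _).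
  rewrite -mulrA; congr (_ * _); rewrite -exprD; congr (_ ^+ _).
  rewrite (eq_bigr _ (fun j _ => u0E j)) big_split /=; congr (_ + _)%N.
  have [ltik|leki] := ltnP i0 k0.
    rewrite (bigD1 i0) //= eqxx big1 // => j /andP[_ /negbTE->] //.
  by rewrite big1 // => j ltj; case: eqP leki => // <-; rewrite leqNgt ltj.
have [vw|nvw] := pselect (forall j, deg_at v j = deg_at w j + (j == i) + (j == k))%N.
  rewrite T1 // T1; last by move=> j; rewrite vw addnAC.
    2: by rewrite eq_sym.
  have -> : tface2 v w k i (c v) = tface2 v w i k (c v).
    by congr (tmap _ _); apply: functional_extensionality_dep => j; rewrite orbC.
  rewrite -scaleNr; congr (_ *: _); rewrite [sgn w k * _]mulrC -mulrN; congr (_ * _).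
  have [_|_|/val_inj e] := ltngtP i k; rewrite ?opprK //.
  by rewrite e eqxx in ik.
by rewrite !T0 ?oppr0 // => vw; apply: nvw => j; rewrite vw addnAC.
Qed.

Definition tensor_complex : complex := Complex (fun p => tdif2 (p := p)).
End TensorComplex.
End Graded.

Section Koszul.
Variables (R : comNzRingType) (G : zmodType) (B : comAlgType R).
Variables (hB : G -> B -> Prop) (m : nat) (L : 'I_m -> B) (w : 'I_m -> G).

Definition ksub p := {S : {set 'I_m} | #|S| == p}.

(* The coordinates, in the basis of the [e_S], [#|S| = p], of an element of   *)
(* the [p]-th exterior power of [B ^ m]; [e_S] has degree the sum of the      *)
(* degrees [w i] of the [L i] for [i] in [S].                                 *)
Definition kobj p : gmod R G :=
  @GMod R G {ffun ksub p -> B} (fun u c =>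
    forall S : ksub p, hB (u - \sum_(i in val S) w i) (c S)).

Definition kcoef p (c : kobj p) (S : {set 'I_m}) : B :=
  if insub S is Some S' then c S' else 0.

Definition ksgn (S : {set 'I_m}) (i : 'I_m) : B :=
  (-1) ^+ #|[set j in S | (j < i)%N]|.

(* d e_S = sum over i in S of (-1) ^ #{j in S | j < i} L_i e_(S - i), read    *)
(* coordinatewise with S = T + i.                                             *)
Definition kdif_fun p (c : kobj p.+1) : kobj p :=
  [ffun T : ksub p => \sum_(i | i \notin val T)
     ksgn (val T) i * L i * kcoef c (i |: val T)].

Fact kcoefP p a (x y : kobj p) S :
  kcoef (a *: x + y) S = a *: kcoef x S + kcoef y S.
Proof. by rewrite /kcoef; case: insub => [T|]; rewrite ?ffunE ?scaler0 ?addr0. Qed.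

Fact kdif_linear p : linear (@kdif_fun p).
Proof.
move=> a x y; apply/ffunP => T; rewrite !ffunE scaler_sumr -big_split /=.
by apply: eq_bigr => i _; rewrite kcoefP mulrDr scalerAr.
Qed.
HB.instance Definition _ p := GRing.isLinear.Build R _ _ _ (@kdif_fun p) (@kdif_linear p).

Lemma kdif2 p (c : kobj p.+2) : kdif_fun (kdif_fun c) = 0.
Proof.
apply/ffunP => U; rewrite !ffunE; set u := val U.
pose t i k : B := if [&& i \notin u, k \notin u & i != k] then
  ksgn u i * L i * (ksgn (i |: u) k * L k * kcoef c (k |: (i |: u))) else 0.
transitivity (\sum_i \sum_k t i k).
  rewrite big_mkcond; apply: eq_bigr => i _; rewrite /t.
  case: ifP => ui /=; last by rewrite big1.
  have ci : #|i |: u| == p.+1 by rewrite cardsU1 ui (eqP (valP U)).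
  rewrite /kcoef insubT ffunE mulr_sumr big_mkcond; apply: eq_bigr => k _ /=.
  by rewrite in_setU1 negb_or eq_sym andbC.
apply: sum_antisym => [i|i k ik]; first by rewrite /t eqxx !andbF.
rewrite /t [k == i]eq_sym ik !andbT [(k \notin u) && _]andbC.
case: ifP => [/andP[ui uk]|_]; last by rewrite oppr0.
have E a b : a \notin u -> ksgn (a |: u) b = (-1) ^+ (a < b)%N * ksgn u b.
  move=> ua; rewrite /ksgn -exprD; congr (_ ^+ _).
  case: ltnP => ab.
    have -> : [set j in a |: u | (j < b)%N] = a |: [set j in u | (j < b)%N].
      by apply/setP => j; rewrite !inE; case: eqP => // ->; rewrite ab.
    by rewrite cardsU1 !inE negb_and ua.
  congr #|pred_of_set _|; apply/setP => j; rewrite !inE; case: eqP => // ->.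
  by rewrite ltnNge ab !andbF.
rewrite setUCA !E // !mulrA -!mulNr; congr (_ * _).
have -> : (-1) ^+ (i < k)%N = - (-1) ^+ (k < i)%N :> B.
  by have [_|_|/val_inj e] := ltngtP i k; rewrite ?opprK //; rewrite e eqxx in ik.
ring.
Qed.

Definition koszul : complex R G := Complex (fun p => kdif2 (p := p)).
End Koszul.

Section Isomorphism.
Variables (R : comNzRingType) (G : zmodType) (C D : complex R G).

(* Isomorphisms of complexes of [R]-modules, homogeneous of degree 0 for the  *)
(* internal gradings.                                                         *)
Definition complex_iso := exists phi : forall p, {linear C p -> D p},
  [/\ forall p, bijective (phi p),
      forall p x, phi p (cdif C p x) = cdif D p (phi p.+1 x)
    & forall p u x, ghom u x <-> ghom u (phi p x)].
End Isomorphism.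

Section Regular.
Variable A : comNzRingType.

Definition in_ideal (s : seq A) (x : A) :=
  exists c : 'I_(size s) -> A, x = \sum_(i < size s) c i * s`_i.

(* Properness of the ideal generated by [s] is part of regularity.            *)
Definition regular_seq (s : seq A) :=
  (forall i, (i < size s)%N ->
     forall x, in_ideal (take i s) (s`_i * x) -> in_ideal (take i s) x)
  /\ ~ in_ideal s 1.

(* The 1-cycles of the Koszul complex of [f, g].                              *)
Definition cycle_pred (f g : A) : {pred (A^o * A^o)%type} :=
  fun z => z.1 * f + z.2 * g == 0.

Fact cycle_submod f g : submod_closed (cycle_pred f g).
Proof.
split=> [|a x y]; rewrite !unfold_in /=; first by rewrite !mul0r addr0.
move=> /eqP xP /eqP yP.
have -> : (a * x.1 + y.1) * f + (a * x.2 + y.2) * g =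
    a * (x.1 * f + x.2 * g) + (y.1 * f + y.2 * g) by ring.
by rewrite xP yP mulr0 addr0.
Qed.
HB.instance Definition _ f g :=
  GRing.isSubmodClosed.Build A (A^o * A^o)%type (cycle_pred f g) (cycle_submod f g).

Record cycles1 (f g : A) := Cycle1 {
  cycle_val :> (A^o * A^o)%type; _ : cycle_val \in cycle_pred f g }.
HB.instance Definition _ f g := [isSub for @cycle_val f g].
HB.instance Definition _ f g := [Choice of cycles1 f g by <:].
HB.instance Definition _ f g := [SubChoice_isSubLmodule of cycles1 f g by <:].
End Regular.

(* Everything is graded by Z x Z^m: the variables of [A] have degree (1, 0),  *)
(* and the variables [x_i] and [y_i] have degree (0, e_i).                    *)
Section Approximation.
Variables (k : fieldType) (N m : nat).
Local Notation A := {mpoly k[N]}.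

Definition mgrade : zmodType := (int * {ffun 'I_m -> int})%type.
Definition tdeg (d : nat) : mgrade := (d%:Z, 0).
Definition vdeg (i : 'I_m) : mgrade := (0, [ffun j => (j == i)%:Z]).

Definition Ahom (u : mgrade) (a : A) :=
  forall s : 'X_{1..N}, a@_s != 0 -> tdeg (mdeg s) = u.

(* [w] gives the degrees of the [r] additional variables.                     *)
Definition Phom r (w : 'I_r -> mgrade) (u : mgrade) (h : {mpoly A[r]}) :=
  forall (s : 'X_{1..N}) (t : 'X_{1..r}), (h@_t)@_s != 0 ->
    tdeg (mdeg s) + \sum_(j < r) w j *+ t j = u.

Section Factor.
Variables (i : 'I_m) (f g : A) (d : nat).

(* Graded as a submodule of the degree 1 term A(-d) ^ 2 of the graded Koszul  *)
(* complex of [f, g].                                                         *)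
Definition Z1 : gmod A mgrade :=
  @GMod A mgrade (cycles1 f g) (fun u z =>
    Ahom (u - tdeg d) (val z).1 /\ Ahom (u - tdeg d) (val z).2).

Definition Pxy : gmod A mgrade :=
  @GMod A mgrade {mpoly A[2]} (Phom (fun _ => vdeg i)).

Local Notation x := ('X_ord0 : {mpoly A[2]}).
Local Notation y := ('X_ord_max : {mpoly A[2]}).

Definition zobj p : gmod A mgrade :=
  match p with
  | 0 => Pxy
  | 1 => gtens2 (gshift Z1 (tdeg d)) (gshift Pxy (- vdeg i))
  | _ => gzero A mgrade
  end.

Definition zdif1_fun (v : forall b, gpair (gshift Z1 (tdeg d)) (gshift Pxy (- vdeg i)) b) : Pxy :=
  let z : cycles1 f g := v false in let h : {mpoly A[2]} := v true in
  ((val z).1 *: x + (val z).2 *: y) * h.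

Fact zdif1_multilinear : multilinear zdif1_fun.
Proof.
move=> v [] a u w; rewrite /zdif1_fun !dfwith_in !dfwith_out //.
  by rewrite mulrDr scalerAr.
have -> : val (a *: u + w : cycles1 f g) = a *: val (u : cycles1 f g) + val (w : cycles1 f g).
  exact: linearP.
by rewrite /= !scalerDl -!scalerA addrACA -scalerDr mulrDl scalerAl.
Qed.

Definition zdif p : {linear zobj p.+1 -> zobj p} :=
  match p with
  | 0 => tlift zdif1_multilinear
  | _ => \0
  end.

Fact zdif2 p (v : zobj p.+2) : zdif p (zdif p.+1 v) = 0.
Proof. by case: p v => [|p] v //=; rewrite linear0. Qed.

Definition approx_complex : complex A mgrade := Complex zdif2.
End Factor.

Local Notation B := {mpoly A[m + m]}.

Definition Bdeg (j : 'I_(m + m)) : mgrade :=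
  match split j with inl i => vdeg i | inr i => vdeg i end.

(* [x_i] is the variable of index [i] and [y_i] that of index [m + i].        *)
Definition Lpoly (f g : 'I_m -> A) (i : 'I_m) : B :=
  f i *: 'X_(rshift m i) - g i *: 'X_(lshift m i).

Definition koszul_L (f g : 'I_m -> A) (d : 'I_m -> nat) : complex A mgrade :=
  koszul (Phom Bdeg) (Lpoly f g) (fun i => tdeg (d i) + vdeg i).
End Approximation.

(* Main.v *)
Require Import Defs.
From HB Require Import structures.
From mathcomp Require Import all_boot all_order all_algebra.
From mathcomp Require Import ring.
From mathcomp Require Import boolp ssrcomplements mpoly.
Set Implicit Arguments.
Unset Strict Implicit.
Unset Printing Implicit Defensive.
Import GRing.Theory.
Local Open Scope ring_scope.

(** Regularity of [f_i, g_i] makes the module of cycles [Z_1] free of rank one on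
    the Koszul syzygy [(- g_i, f_i)] ([regular_cycle_coord]).  Once this generator
    is identified with the basis vector [e_i], the [i]-th approximation complex is
    [A[x_i, y_i] e_i -> A[x_i, y_i]], and it sends [e_i] to
    [- g_i x_i + f_i y_i = L_i]: it is the Koszul complex of the single element
    [L_i] over [A[x_i, y_i]].  Tensoring over [A] multiplies the polynomial rings
    into [A[x_0, y_0, .., x_n, y_n]] and turns Koszul complexes of one element into
    the Koszul complex of the sequence, with the same signs.

    The second half of this argument ([tensor_koszul_iso]) only uses a family of
    complexes [C_j] concentrated in degrees 0 and 1, an algebra [B], and maps from
    [C_j] to [B] that send generators of either term to the same elements
    [mon t] of [B], the products of which form a basis of [B].  A summand of the
    tensor complex vanishes unless its multi-index is the indicator of a set [S],
    and then multiplying the images in [B] of the factors identifies it with the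
    coordinate of the Koszul complex along [e_S] ([tens_embK], [tens_genK]).  The
    inverse is defined on the basis of [B]; that it is a left inverse is checked on
    tensors of generators, because a multilinear map is determined by its values
    there ([multilinear_eq]).

    The gradings are preserved in both directions.  From the tensor complex to
    [B] the only point is that the coordinate of a homogeneous cycle along the
    syzygy is homogeneous, which holds because it is obtained by cancelling the
    nonzero homogeneous factor [f_i] ([Ahom_cancel]).  Conversely, a homogeneous
    element of [B] is a combination of monomials with homogeneous coefficients,
    and each coefficient can be absorbed in one factor of a pure tensor
    ([tens_gen_hom]). *)

(** * Spanning families and multilinear maps *)

Definition family_span (R : comNzRingType) (M : lmodType R) (K : Type)
    (e : K -> M) : {pred M} := mspan (fun y => exists t, y = e t).

Definition spans (R : comNzRingType) (M : lmodType R) (K : Type) (e : K -> M) :=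
  forall x, x \in family_span e.

Section Spanning.
Variables (R : comNzRingType) (M N : lmodType R) (K : Type) (e : K -> M).

HB.instance Definition _ := GRing.isSubmodClosed.Build R M (family_span e)
  (@mspan_submod R M (fun y => exists t, y = e t)).

Lemma family_span_mem t : e t \in family_span e.
Proof. by apply: mspan_rel; exists t. Qed.

Lemma family_span_min (S : {pred M}) :
  submod_closed S -> (forall t, e t \in S) -> {subset family_span e <= S}.
Proof. by move=> clS eS; apply: mspan_min => // _ [t ->]. Qed.

Lemma linear_eq_spans (f g : {linear M -> N}) :
  spans e -> (forall t, f (e t) = g (e t)) -> f =1 g.
Proof.
move=> espan fg x; pose S : {pred M} := [pred x | f x == g x].
suff /(_ x (espan x))/eqP : {subset family_span e <= S} by [].
apply: family_span_min => [|t]; last by rewrite inE fg.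
split=> [|a u v]; rewrite !inE ?linear0 // => /eqP uS /eqP vS.
by rewrite !linearP uS vS.
Qed.

End Spanning.

Lemma family_span_image (R : comNzRingType) (M N : lmodType R) (K : Type)
    (e : K -> M) (f : {linear M -> N}) x :
  x \in family_span e -> f x \in family_span (f \o e).
Proof.
pose S : {pred M} := [pred x | f x \in family_span (f \o e)].
suff /(_ x) : {subset family_span e <= S} by [].
apply: family_span_min => [|t]; last by rewrite inE (family_span_mem (f \o e)).
split=> [|a u v]; rewrite !inE ?linear0 ?rpred0 // => uS vS.
by rewrite linearP rpredD ?rpredZ.
Qed.

Lemma spans_trans (R : comNzRingType) (M : lmodType R) (K K' : Type)
    (e : K -> M) (e' : K' -> M) :
  spans e -> (forall t, e t \in family_span e') -> spans e'.
Proof.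
by move=> espan ee' x; apply: (family_span_min _ ee' (espan x)); apply: mspan_submod.
Qed.

Lemma pure_spans (R : comNzRingType) (I : eqType) (M : I -> lmodType R) :
  spans (@pure R I M).
Proof.
move=> t; rewrite -[t]mreprK [mrepr t]freemodE raddf_sum; apply: rpred_sum => x _ /=.
by rewrite linearZ rpredZ //; apply: (family_span_mem (@pure R I M) x).
Qed.

Lemma dfwith_id (I : eqType) (T : I -> Type) (x : forall i, T i) i :
  dfwith x (x i) = x.
Proof.
apply: functional_extensionality_dep => j; have [e|ne] := eqVneq i j.
  by case: _ / e; rewrite dfwith_in.
by rewrite dfwith_out.
Qed.

Section PureAt.
Variables (R : comNzRingType) (I : eqType) (M : I -> lmodType R).
Variables (x : forall i, M i) (i : I).

Definition pure_at (u : M i) : tens M := pure (dfwith x u).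

Fact pure_at_linear : linear pure_at.
Proof. by move=> a u v; apply: pure_multilinear. Qed.
HB.instance Definition _ :=
  GRing.isLinear.Build R (M i) (tens M) _ pure_at pure_at_linear.
End PureAt.

Lemma tens_trivial (R : comNzRingType) (I : eqType) (M : I -> lmodType R) i :
  (forall x : M i, x = 0) -> forall t : tens M, t = 0.
Proof.
move=> M0; apply: (@tens_ind _ _ _ _ idfun \0) => x /=.
exact: (pure_eq0 (M0 _)).
Qed.

(** Two maps that agree up to a factor [L] on pure tensors do so everywhere; the
    factor is that of a Koszul differential. *)
Lemma tens_ind_mul (R : comNzRingType) (B : comAlgType R) (I : eqType)
    (M : I -> lmodType R) (P : lmodType R) (e : {linear P -> B})
    (f : {linear tens M -> P}) (g : {linear tens M -> B}) (L : B) :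
  (forall x, e (f (pure x)) = L * g (pure x)) -> forall t, e (f t) = L * g t.
Proof.
move=> efg t; have := pure_spans t.
pose S : {pred tens M} := [pred t | e (f t) == L * g t].
suff /(_ t) : {subset family_span (@pure R I M) <= S} by move=> tS /tS/eqP.
apply: family_span_min => [|x]; last by rewrite inE efg.
split=> [|a u v]; rewrite !inE ?linear0 ?mulr0 // => /eqP uS /eqP vS.
by rewrite !linearP uS vS mulrDr scalerAr.
Qed.

(** The arguments are replaced by generators one at a time: with all arguments but
    the [i]-th one fixed, both sides are linear in that argument, so the elements
    on which they agree form a submodule. *)
Lemma multilinear_eq (R : comNzRingType) (I : finType) (M : I -> lmodType R)
    (N : lmodType R) (K : I -> Type) (e : forall i, K i -> M i)
    (F G : (forall i, M i) -> N) :
    multilinear F -> multilinear G -> (forall i, spans (e i)) ->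
    (forall t : forall i, K i,
       F (fun i => e i (t i)) = G (fun i => e i (t i))) ->
  forall x, F x = G x.
Proof.
move=> mF mG espan FG.
(* [A] contains the indices at which the argument need not be a generator. *)
suff FGA n (A : {set I}) : (#|A| <= n)%N -> forall x,
    (forall i, i \notin A -> exists t, x i = e i t) -> F x = G x.
  by move=> x; apply: (FGA #|I| setT) => [|i]; rewrite ?cardsT // inE.
elim: n A => [|n IHn] A Acard x xA.
  have xe i : exists t, x i = e i t.
    by apply: xA; move: Acard; rewrite leqn0 cards_eq0 => /eqP ->; rewrite inE.
  have -> : x = fun i => e i (projT1 (boolp.cid (xe i))).
    by apply: functional_extensionality_dep => i; case: (boolp.cid (xe i)).
  exact: FG.
have [A0|[i iA]] := set_0Vmem A.
  by apply: (IHn A) => //; rewrite A0 cards0.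
have mult0 H : multilinear H -> H (dfwith x (0 : M i)) = 0 :> N.
  by move=> /(_ x i (-1) 0 0); rewrite scaler0 addr0 scaleN1r addNr.
pose S : {pred M i} := [pred u | F (dfwith x u) == G (dfwith x u)].
suff /(_ (x i) (espan i _))/eqP : {subset family_span (@e i) <= S}.
  by rewrite dfwith_id.
apply: family_span_min => [|t].
  split=> [|a u v]; rewrite !inE ?mult0 // => /eqP uS /eqP vS.
  by rewrite mF mG uS vS.
apply/eqP/(IHn (A :\ i)) => [|j].
  by move: Acard; rewrite (cardsD1 i A) iA.
rewrite in_setD1 negb_and negbK; have [-> _|ji /= jA] := eqVneq j i.
  by exists t; rewrite dfwith_in.
by rewrite dfwith_out 1?eq_sym //; apply: xA.
Qed.

(** * Monomials as a basis *)

Section MonomialBasis.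
Variables (n : nat) (R : comNzRingType).

Lemma mpolyX_spans : spans (fun t : 'X_{1..n} => 'X_[R, t]).
Proof.
move=> p; rewrite [p]mpolyE; apply: rpred_sum => t _.
by apply/rpredZ/(family_span_mem (fun t : 'X_{1..n} => 'X_[R, t])).
Qed.

Variables (N : lmodType R) (F : 'X_{1..n} -> N).

(** The polynomial ring is a free module on its monomials; this is the extension
    by linearity of a function on monomials. *)
Definition mpoly_lift (p : {mpoly R[n]}) : N := flift F (mpoly_val p).

Fact mpoly_lift_linear : linear mpoly_lift.
Proof.
by move=> a p q; rewrite /mpoly_lift -linearP; congr (flift F _).
Qed.
HB.instance Definition _ :=
  GRing.isLinear.Build R {mpoly R[n]} N _ mpoly_lift mpoly_lift_linear.

Lemma mpoly_liftX t : mpoly_lift 'X_[t] = F t.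
Proof. by rewrite /mpoly_lift -[RHS](flift_gen F) unlock. Qed.

End MonomialBasis.

(** The variables [x_i] and [y_i], to be substituted for [x] and [y]. *)
Definition block_vars (R : comNzRingType) m (i : 'I_m) : 2.-tuple {mpoly R[m + m]} :=
  [tuple 'X_(lshift m i); 'X_(rshift m i)].

Section Blocks.
Variable m : nat.

(** A monomial in all the variables is the same thing as a family of monomials in
    [x_j, y_j], one for each [j]. *)
Definition block_monomial (s : 'X_{1..m + m}) (j : 'I_m) : 'X_{1..2} :=
  [multinom [tuple s (lshift m j); s (rshift m j)]].

Definition glue_monomials (t : 'I_m -> 'X_{1..2}) : 'X_{1..m + m} :=
  [multinom match split l with inl j => t j ord0 | inr j => t j ord_max end
  | l < m + m].

Lemma block_glue t : block_monomial (glue_monomials t) = t.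
Proof.
apply: funext => j; apply/mnmP => l; rewrite multinomE (tnth_nth 0%N) /= !mnmE.
rewrite -[lshift m j]/(unsplit (inl _ j)) -[rshift m j]/(unsplit (inr _ j)) !unsplitK.
by case: l => [[|[|l]] lP] //=; congr (t j _); apply: val_inj.
Qed.

Lemma block_sum (V : nmodType) (s : 'X_{1..m + m}) (e : 'I_(m + m) -> V) :
  \sum_j (e (lshift m j) *+ block_monomial s j ord0 +
          e (rshift m j) *+ block_monomial s j ord_max) = \sum_l e l *+ s l.
Proof.
rewrite big_split_ord /= -big_split; apply: eq_bigr => j _ /=.
by rewrite !multinomE.
Qed.

Variable R : comNzRingType.

Lemma prod_block_monomials (s : 'X_{1..m + m}) :
  \prod_j ('X_[block_monomial s j] \mPo block_vars R j) = 'X_[R, s].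
Proof.
rewrite mpolyXE_id big_split_ord /= -big_split; apply: eq_bigr => j _ /=.
by rewrite comp_mpolyX !big_ord_recl big_ord0 mulr1 !multinomE.
Qed.
End Blocks.

Section BlockBasis.
Variables (R : comNzRingType) (m : nat).
Local Notation B := {mpoly R[m + m]}.

Lemma prod_glue_monomials (t : 'I_m -> 'X_{1..2}) :
  \prod_j ('X_[t j] \mPo block_vars R j) = 'X_[R, glue_monomials t].
Proof. by rewrite -prod_block_monomials block_glue. Qed.

Lemma block_products_span :
  spans (fun t : 'I_m -> 'X_{1..2} => \prod_j ('X_[t j] \mPo block_vars R j) : B).
Proof.
apply: spans_trans (@mpolyX_spans _ R) _ => s; rewrite -prod_block_monomials.
exact: (family_span_mem (fun t : 'I_m -> 'X_{1..2} =>
  \prod_j ('X_[t j] \mPo block_vars R j) : B) (block_monomial s)).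
Qed.

Definition block_lift (N : lmodType R) (F : ('I_m -> 'X_{1..2}) -> N) :
  {linear B -> N} := mpoly_lift (fun s => F (block_monomial s)).

Lemma block_liftE (N : lmodType R) (F : ('I_m -> 'X_{1..2}) -> N) t :
  block_lift F (\prod_j ('X_[t j] \mPo block_vars R j)) = F t.
Proof. by rewrite prod_glue_monomials /block_lift /= mpoly_liftX block_glue. Qed.
End BlockBasis.

(** * Cycles of a regular sequence of length two *)

Lemma regular_seq_head_neq0 (A : comNzRingType) (f : A) s :
  regular_seq (f :: s) -> f != 0.
Proof.
case=> reg _; apply/eqP => f0; have [|c] := reg 0%N isT 1.
  by exists (fun _ => 0); rewrite big_ord0 /= f0 mul0r.
by rewrite big_ord0 => /eqP; rewrite oner_eq0.
Qed.

Section CyclesFree.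
Variables (A : comNzRingType) (f g : A).

Fact koszul_cycle_subproof : ((- g, f) : A^o * A^o) \in cycle_pred f g.
Proof. by rewrite unfold_in /= mulNr mulrC addNr. Qed.
Definition koszul_cycle : cycles1 f g := Cycle1 koszul_cycle_subproof.

(** If [a f + b g = 0] then [g b] lies in the ideal of [f], so [b = c f] by
    regularity, and cancelling the nonzerodivisor [f] in [a f = - c f g] gives
    [a = - c g].  The coordinate [c] is unique, hence linear in the cycle. *)
Lemma regular_cycle_coord : regular_seq [:: f; g] ->
  exists c : {linear cycles1 f g -> A^o},
    c koszul_cycle = 1 /\ forall z, z = (c z : A) *: koszul_cycle.
Proof.
case=> reg _.
have freg x : f * x = 0 -> x = 0.
  move=> fx0; have [|c ->] := reg 0%N isT x; last by rewrite big_ord0.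
  by exists (fun _ => 0); rewrite big_ord0.
have finj x y : x * f = y * f -> x = y.
  move=> /eqP; rewrite -subr_eq0 -mulrBl mulrC => /eqP/freg/eqP.
  by rewrite subr_eq0 => /eqP.
have cE (z : cycles1 f g) : exists a, (val z).2 = a * f.
  have /eqP zP := valP z.
  have [|c] := reg 1%N isT (val z).2.
    exists (fun _ => - (val z).1); rewrite big_ord1 mulNr mulrC.
    by apply/eqP; rewrite -addr_eq0 addrC zP.
  by rewrite big_ord1 => e; exists (c ord0).
pose c z := projT1 (boolp.cid (cE z)).
have cP z : (val z).2 = c z * f by rewrite /c; case: (boolp.cid (cE z)).
have clin : linear (c : cycles1 f g -> A^o).
  move=> a x y; apply: finj; transitivity (a * (c x * f) + c y * f).
    by rewrite -!cP linearP.
  by rewrite -[_ *: (c x : A^o)]/(a * c x); ring.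
exists (HB.pack_for {linear cycles1 f g -> A^o} (c : cycles1 f g -> A^o)
  (GRing.isLinear.Build A (cycles1 f g) A^o _ c clin)); split=> /=.
  by apply: finj; rewrite -cP mul1r.
move=> z; apply: val_inj; have /eqP := valP z; rewrite linearZ /=.
rewrite cP => zP; rewrite [LHS]surjective_pairing cP; congr pair.
apply: finj; apply/eqP; rewrite -subr_eq0 -zP.
by apply/eqP; rewrite /GRing.scale /=; ring.
Qed.
End CyclesFree.

(** * Homogeneous polynomials *)

Section Homogeneity.
Variables (k : fieldType) (N m : nat).
Local Notation A := {mpoly k[N]}.
Local Notation G := (mgrade m).
Implicit Types (a b : A) (u v : G).

Lemma tdegD d e : tdeg m (d + e) = tdeg m d + tdeg m e.
Proof. by rewrite /tdeg -[RHS]/(_, _) /= addr0. Qed.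

Lemma Ahom0 u : Ahom u (0 : A).
Proof. by move=> s; rewrite mcoeff0 eqxx. Qed.

Lemma AhomD u a b : Ahom u a -> Ahom u b -> Ahom u (a + b).
Proof.
move=> ua ub s; rewrite mcoeffD => ab.
have [a0|/ua //] := eqVneq a@_s 0.
by apply: ub; rewrite a0 add0r in ab.
Qed.

Lemma AhomM u v a b : Ahom u a -> Ahom v b -> Ahom (u + v) (a * b).
Proof.
move=> ua vb s; rewrite -mcoeff_msupp => /msuppM_le /allpairsP[[s1 s2] /=].
rewrite !mcoeff_msupp => -[/ua<- /vb<- ->].
by rewrite mdegD tdegD.
Qed.

Lemma Ahom_dhomog d a : a \is d.-homog -> Ahom (tdeg m d) a.
Proof.
by move=> /dhomogP ad s; rewrite -mcoeff_msupp => /ad /= <-.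
Qed.

(** Each homogeneous component of [a] is multiplied by [b] to a homogeneous
    component of [a b], and this product is nonzero over a domain; so only one
    component of [a] can be nonzero. *)
Lemma Ahom_cancel d u a b : b != 0 -> b \is d.-homog -> Ahom u (a * b) ->
  Ahom (u - tdeg m d) a.
Proof.
move=> b0 bd uab s as0; set e := mdeg s.
pose ae := pihomog mdeg e a.
have ae0 : ae != 0.
  apply: contra_neq as0 => /(congr1 (mcoeff s)); rewrite mcoeff0 => <-.
  rewrite /ae pihomogE raddf_sum /=.
  have [sa|sa] := boolP (s \in msupp a).
    rewrite big_mkcond (bigD1_seq s) ?msupp_uniq //= eqxx mcoeffZ mcoeffX eqxx.
    rewrite mulr1 big1 ?addr0 // => t ts; case: ifP => // _.
    by rewrite mcoeffZ mcoeffX (negbTE ts) mulr0.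
  rewrite memN_msupp_eq0 // big_seq_cond big1 // => t /andP[ta _].
  rewrite mcoeffZ mcoeffX; have [ts|_] := eqVneq t s; last by rewrite mulr0.
  by rewrite ts (negbTE sa) in ta.
have aeb : ae * b = pihomog mdeg (e + d) (a * b).
  rewrite [in RHS](mpolyE a) /ae pihomogE !mulr_suml linear_sum /= big_mkcond.
  apply: eq_bigr => t _; rewrite -scalerAl linearZ /=.
  have tb : 'X_[t] * b \is (mdeg t + d).-homog by rewrite dhomogM ?dhomogX.
  case: eqP => [<-|/eqP te]; first by rewrite pihomog_dE // scalerAl.
  by rewrite (pihomog_ne0 _ tb) ?scaler0 // eqn_add2r.
have : ae * b != 0 by rewrite mulf_neq0.
rewrite aeb pihomogE; have [<-|ude] := eqVneq (tdeg m (e + d)) u.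
  by rewrite tdegD addrK.
rewrite big_seq_cond big_pred0 ?eqxx // => t; apply/negP => /andP[].
rewrite mcoeff_msupp => /uab; case: eqP => // ->.
by move/eqP; rewrite (negbTE ude).
Qed.

Section Phom.
Variables (r : nat) (w : 'I_r -> G).
Implicit Types p q : {mpoly A[r]}.

(** This turns a condition on the terms in both sets of variables into one on the
    coefficients, to which the lemmas on [Ahom] apply. *)
Lemma Phom_coef u p : Phom w u p <->
  forall t, Ahom (u - \sum_j w j *+ (t : 'X_{1..r}) j) p@_t.
Proof.
split=> [up t s pts|up s t pts]; first by rewrite -(up _ _ pts) addrK.
by rewrite (up _ _ pts) subrK.
Qed.

Lemma Phom0 u : Phom w u (0 : {mpoly A[r]}).
Proof. by apply/Phom_coef => t; rewrite mcoeff0; apply: Ahom0. Qed.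

Lemma PhomD u p q : Phom w u p -> Phom w u q -> Phom w u (p + q).
Proof.
move=> /Phom_coef up /Phom_coef uq; apply/Phom_coef => t.
by rewrite mcoeffD; apply: AhomD.
Qed.

Lemma Phom_sum u (I : Type) (s : seq I) (P : pred I) (F : I -> {mpoly A[r]}) :
  (forall i, P i -> Phom w u (F i)) -> Phom w u (\sum_(i <- s | P i) F i).
Proof. by move=> uF; apply: big_ind => //; [apply: Phom0 | apply: PhomD]. Qed.

Lemma PhomZ u v a p : Ahom u a -> Phom w v p -> Phom w (u + v) (a *: p).
Proof.
move=> ua /Phom_coef vp; apply/Phom_coef => t.
by rewrite mcoeffZ -addrA; apply: AhomM.
Qed.

Lemma PhomX (t : 'X_{1..r}) : Phom w (\sum_j w j *+ t j) ('X_[t] : {mpoly A[r]}).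
Proof.
apply/Phom_coef => t'; rewrite mcoeffX; have [<-|_] := eqVneq t t'; last exact: Ahom0.
by rewrite subrr; apply: (@Ahom_dhomog 0); apply: dhomog1.
Qed.

Lemma Phom1 : Phom w 0 (1 : {mpoly A[r]}).
Proof.
by rewrite -mpolyX0; move: (@PhomX 0%MM); rewrite big1 // => j _; rewrite mnm0E.
Qed.

Lemma PhomM u v p q : Phom w u p -> Phom w v q -> Phom w (u + v) (p * q).
Proof.
move=> /Phom_coef up /Phom_coef vq.
rewrite [p]mpolyE mulr_suml; apply: Phom_sum => s _.
rewrite [q]mpolyE mulr_sumr; apply: Phom_sum => t _.
rewrite -scalerAl -scalerAr scalerA -mpolyXD.
move: (PhomZ (AhomM (up s) (vq t)) (@PhomX (s + t)%MM)).
have -> : \sum_j w j *+ (s + t)%MM j = \sum_j w j *+ s j + \sum_j w j *+ t j.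
  by rewrite -big_split; apply: eq_bigr => j _; rewrite mnmDE mulrnDr.
by rewrite addrACA !subrK.
Qed.

Lemma Phom_prod (I : finType) (u : I -> G) (F : I -> {mpoly A[r]}) :
  (forall i, Phom w (u i) (F i)) -> Phom w (\sum_i u i) (\prod_i F i).
Proof.
by move=> uF; apply: (big_ind2 (Phom w)) => //; [apply: Phom1 | move=> *; apply: PhomM].
Qed.

End Phom.

Lemma Phom_comp r r' (w : 'I_r -> G) (w' : 'I_r' -> G) (lq : r'.-tuple {mpoly A[r]}) u
    (p : {mpoly A[r']}) :
  (forall j, Phom w (w' j) (tnth lq j)) -> Phom w' u p -> Phom w u (p \mPo lq).
Proof.
move=> wlq /Phom_coef up; rewrite [p]mpolyE linear_sum; apply: Phom_sum => t _ /=.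
rewrite comp_mpolyZ comp_mpolyX -[u](subrK (\sum_j w' j *+ t j)).
apply: PhomZ (up t) _; apply: Phom_prod => j.
elim: (t j) => [|n IHn]; first by rewrite expr0; apply: Phom1.
by rewrite mulrS exprS; apply: PhomM.
Qed.
End Homogeneity.

Lemma Phom_block_expand (k : fieldType) (N m : nat) (u : mgrade m)
    (b : {mpoly {mpoly k[N]}[m + m]}) : Phom (@Bdeg m) u b ->
  exists r (a : 'I_r -> {mpoly k[N]}) (t : 'I_r -> 'I_m -> 'X_{1..2}),
    (forall l, Ahom (u - \sum_j \sum_h vdeg j *+ t l j h) (a l)) /\
    b = \sum_l a l *: \prod_j ('X_[t l j] \mPo block_vars {mpoly k[N]} j).
Proof.
move=> ub; pose s (l : 'I_(size (msupp b))) := tnth (in_tuple (msupp b)) l.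
exists (size (msupp b)), (fun l => b@_(s l)), (fun l => block_monomial (s l)).
split=> [l|]; last first.
  rewrite {1}[b]mpolyE big_tnth; apply: eq_bigr => l _.
  by rewrite prod_block_monomials.
have /Phom_coef/(_ (s l)) := ub; congr (Ahom (_ - _) _).
rewrite -block_sum; apply: eq_bigr => j _.
rewrite !big_ord_recl big_ord0 addr0 /Bdeg.
by rewrite -[lshift m j]/(unsplit (inl _ j)) -[rshift m j]/(unsplit (inr _ j)) !unsplitK.
Qed.

(** * The approximation complex of a regular pair *)

Lemma comp_mpoly_linear_form (R : comNzRingType) n (lq : 2.-tuple {mpoly R[n]})
    (c f g : R) h :
  (((c * - g) *: 'X_ord0 + (c * f) *: 'X_ord_max) * h) \mPo lq =
  (f *: lq`_1 - g *: lq`_0) * (c *: (h \mPo lq)).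
Proof.
rewrite rmorphM rmorphD /= !comp_mpolyZ !comp_mpolyXU -scalerAr scalerAl.
by rewrite scalerBr !scalerA mulrN scaleNr addrC.
Qed.

Section Factor.
Variables (k : fieldType) (N m : nat).
Local Notation A := {mpoly k[N]}.
Local Notation B := {mpoly A[m + m]}.
Variables (i : 'I_m) (f g : A) (d : nat).
Hypotheses (f_homog : f \is d.-homog) (g_homog : g \is d.-homog).

Local Notation emb_vars := (block_vars A i).
Local Notation emb h := ((h : {mpoly A[2]}) \mPo emb_vars).

Local Notation zfac :=
  (gpair (gshift (Z1 m f g d) (tdeg m d)) (gshift (Pxy k N i) (- vdeg i))).
Local Notation zob := (zobj i f g d).

(** The pair [(z, h)] as a dependent function on [bool], the form of the
    arguments of a twofold tensor product. *)
Definition zpair (z : cycles1 f g) (h : {mpoly A[2]}) b : zfac b :=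
  if b as b' return zfac b' then h else z.

Lemma zpair_eta (v : forall b, zfac b) : v = zpair (v false) (v true).
Proof. by apply: functional_extensionality_dep => -[]. Qed.

Lemma zpair_withl z h u : dfwith (zpair z h) (u : zfac false) = zpair u h.
Proof.
by apply: functional_extensionality_dep => -[]; rewrite ?dfwith_in ?dfwith_out.
Qed.

Lemma zpair_withr z h u : dfwith (zpair z h) (u : zfac true) = zpair z u.
Proof.
by apply: functional_extensionality_dep => -[]; rewrite ?dfwith_in ?dfwith_out.
Qed.

Lemma pure_zpairZ a z h :
  a *: pure (zpair z h) = pure (zpair (a *: z) h) :> tens zfac.
Proof.
rewrite -(zpair_withl z h z) -(zpair_withl z h (a *: z)).
exact: esym (linearZZ (pure_at (zpair z h) (i := false)) a z).
Qed.

Local Notation gen_pure := (pure_at (zpair (koszul_cycle f g) 0) (i := true)).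

Lemma gen_pureE h : gen_pure h = pure (zpair (koszul_cycle f g) h).
Proof. by rewrite /pure_at zpair_withr. Qed.

Definition zgen p (t : 'X_{1..2}) : zob p :=
  match p with
  | 0 => 'X_[t] : {mpoly A[2]}
  | 1 => gen_pure ('X_[t] : {mpoly A[2]})
  | _ => 0
  end.

Lemma zobj_big p (x : zob p.+2) : x = 0.
Proof. by apply/matrixP => a []. Qed.

Lemma zgen_hom p u a t : Ahom u a ->
  ghom (u + \sum_j vdeg i *+ (t : 'X_{1..2}) j + (tdeg m d + vdeg i) *+ p)
       (a *: zgen p t).
Proof.
case: p => [|[|p]] ua //=.
  by rewrite addr0; exact: (PhomZ ua (@PhomX _ _ _ _ (fun=> vdeg i) t)).
exists 1%N, (fun _ => zpair (a *: koszul_cycle f g) 'X_[t]).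
exists (fun _ b => if b then \sum_j vdeg i *+ t j + vdeg i else u + tdeg m d); split.
- move=> _ [] /=; first by rewrite addrK; apply: PhomX.
  by rewrite addrK; split; apply: AhomM => //; apply: Ahom_dhomog; rewrite ?rpredN.
- by move=> _; rewrite big_bool /= addrC addrACA [X in X + _]addrC.
- by rewrite big_ord1 -pure_zpairZ -gen_pureE.
Qed.

Variable c : {linear cycles1 f g -> A^o}.
Hypothesis c1 : c (koszul_cycle f g) = 1.
Hypothesis cK : forall z, z = (c z : A) *: koszul_cycle f g.

Definition zemb1_fun (v : forall b, zfac b) : B := (c (v false) : A) *: emb (v true).

Fact zemb1_multilinear : multilinear zemb1_fun.
Proof.
move=> v [] a x y; rewrite /zemb1_fun !dfwith_in !dfwith_out //.
  by rewrite comp_mpolyD comp_mpolyZ scalerDr !scalerA mulrC.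
by rewrite linearP scalerDl scalerA.
Qed.

(** Both terms of the complex are mapped to the big polynomial ring, by the
    substitution of [x_i, y_i] for [x, y]; in degree 1 the cycle is first replaced
    with its coordinate [c] along the syzygy. *)
Definition zemb p : {linear zob p -> B} :=
  match p with
  | 0 => comp_mpoly emb_vars
  | 1 => tlift zemb1_multilinear
  | _ => \0
  end.

(** In degree 1, freeness of the module of cycles allows the coordinate of [z] to be
    moved to the other factor of [z (x) h], which is then a multiple of a tensor of
    the syzygy with a polynomial. *)
Lemma zgen_spans p : spans (@zgen p).
Proof.
case: p => [|[|p]] /=; first exact: mpolyX_spans.
  apply: (spans_trans (@pure_spans _ _ _)) => v; rewrite (zpair_eta v) [v false]cK.
  rewrite -pure_zpairZ -gen_pureE; apply: rpredZ.
  exact: (family_span_image gen_pure (mpolyX_spans _)).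
by move=> x; rewrite (@zobj_big p x); apply: rpred0.
Qed.

Lemma zemb_gen p t : (p < 2)%N -> zemb p (zgen p t) = emb 'X_[t].
Proof.
by case: p => [|[|]] //= _; rewrite gen_pureE tlift_pure /zemb1_fun /= c1 scale1r.
Qed.

(** The cycle [z = c z (- g, f)] is sent by the differential to
    [c z (- g x + f y)], which is where the Koszul element comes from. *)
Lemma zemb_dif x : zemb 0 (zdif i f g d 0 x) =
  (f *: 'X_(rshift m i) - g *: 'X_(lshift m i)) * zemb 1 x.
Proof.
move: x; apply: (tens_ind_mul (e := comp_mpoly emb_vars)
  (f := tlift (@zdif1_multilinear k N m i f g d)) (g := tlift zemb1_multilinear)).
move=> v; rewrite /= !tlift_pure /zdif1_fun /zemb1_fun.
move: (v false : cycles1 f g) (v true : {mpoly A[2]}) => z h /=.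
have z1 : (val z).1 = (c z : A) * - g by rewrite {1}[z]cK linearZ.
have z2 : (val z).2 = (c z : A) * f by rewrite {1}[z]cK linearZ.
by rewrite z1 z2 comp_mpoly_linear_form.
Qed.

Lemma emb_hom u h : Phom (fun=> vdeg i) u h -> Phom (@Bdeg m) u (emb h).
Proof.
apply: Phom_comp => j; set b := tnth _ j.
have XB l : Phom (@Bdeg m) (Bdeg l) ('X_l : B).
  have := @PhomX _ _ _ _ (@Bdeg m) U_(l)%MM.
  rewrite (bigD1 l) //= mnm1E eqxx big1 ?addr0 //.
  by move=> j' /negbTE jl; rewrite mnm1E eq_sym jl.
have := XB (lshift m i); have := XB (rshift m i); rewrite /Bdeg.
rewrite -[lshift m i]/(unsplit (inl _ i)) -[rshift m i]/(unsplit (inr _ i)) !unsplitK.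
rewrite /b (tnth_nth 0); case: j {b} => [[|[|j]] jP] //=.
Qed.

Lemma zemb_hom p u x : f != 0 -> ghom u x ->
  Phom (@Bdeg m) (u - (tdeg m d + vdeg i) *+ p) (zemb p x).
Proof.
move=> f0; case: p x => [|[|p]] x /=.
- by move=> ux; rewrite subr0; exact: emb_hom ux.
- case=> r [y] [w] [yw wu ->]; rewrite linear_sum; apply: Phom_sum => l _ /=.
  rewrite tlift_pure /zemb1_fun.
  have -> : u - (tdeg m d + vdeg i) = w l false - tdeg m d + (w l true + - vdeg i).
    by rewrite -(wu l) big_bool [RHS]addrACA opprD; congr (_ + _); apply: addrC.
  have [[_ z2] h2] := (yw l false, yw l true).
  apply: PhomZ (emb_hom h2).
  apply: (Ahom_cancel f0 f_homog).
  by move: z2; rewrite addrK {1}[y l false]cK linearZ.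
- by move=> _; apply: Phom0.
Qed.

End Factor.

(** * Tensor products of Koszul complexes of one element *)

(** The data: a scalar ring [R] and an [R]-algebra [B], graded by [hR] and [hB];
    for each [j], a complex [C j] with generators [gen p t] of its term of degree
    [p], of internal degree [wt t + w j *+ p], and a map [emb] to [B] that sends
    [gen 0 t] and [gen 1 t] to the same element [mon t].  The function [lift]
    together with [mon_spans] says that the products of the [mon t] form a
    basis of [B]. *)
Section TensorKoszul.
Variables (R : comNzRingType) (G : zmodType) (B : comAlgType R) (m : nat).
Variables (hR : G -> R -> Prop) (hB : G -> B -> Prop).
Variables (L : 'I_m -> B) (w : 'I_m -> G) (C : 'I_m -> complex R G).

Variables (K : 'I_m -> Type) (mon : forall j, K j -> B) (wt : forall j, K j -> G).
Variable gen : forall j p, K j -> C j p.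
Variable emb : forall j p, {linear C j p -> B}.
Variable lift : forall N : lmodType R, ((forall j, K j) -> N) -> {linear B -> N}.

Hypothesis C_short : forall j p (x : C j p.+2), x = 0.
Hypothesis gen_spans : forall j p, spans (@gen j p).
Hypothesis emb_gen : forall j p t, (p < 2)%N -> emb j p (gen p t) = mon t.
Hypothesis emb_dif : forall j x, emb j 0 (cdif (C j) 0 x) = L j * emb j 1 x.
Hypothesis mon_spans : spans (fun t : forall j, K j => \prod_j mon (t j)).
Hypothesis lift_mon : forall (N : lmodType R) (F : (forall j, K j) -> N) t,
  lift F (\prod_j mon (t j)) = F t.

Section MultiDegree.
Variable v : 'I_m -> nat.
Local Notation tv := (tens (fun j => C j (v j))).

Definition emb_prod (x : forall j, C j (v j)) : B := \prod_j emb j (v j) (x j).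

Fact emb_prod_multilinear : multilinear emb_prod.
Proof.
move=> x i a y z; rewrite /emb_prod !(bigD1 (P := predT) i) //= !dfwith_in.
have E (u : C i (v i)) : \prod_(j | j != i) emb j (v j) (dfwith x u j) =
           \prod_(j | j != i) emb j (v j) (x j).
  by apply: eq_bigr => j; rewrite eq_sym => ij; rewrite dfwith_out.
by rewrite !E linearP mulrDl scalerAl.
Qed.

(** [tens_emb] and [tens_gen] are inverse to each other when [v] is a 0/1-valued
    multi-index; otherwise the tensor product is zero, and [tens_gen] is still a
    left inverse of [tens_emb]. *)
Definition tens_emb : {linear tv -> B} := tlift emb_prod_multilinear.

Definition tens_gen : {linear B -> tv} :=
  lift (fun t => pure (fun j => gen (v j) (t j)) : tv).

Lemma tens_eq0 j (t : tv) : (1 < v j)%N -> t = 0.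
Proof.
move=> vj; apply: (tens_trivial (i := j)) => x; move: x.
by case: (v j) vj => [|[|p]] // _ x; apply: C_short.
Qed.

Lemma tens_embK : cancel tens_emb tens_gen.
Proof.
move=> t; have [/forallP v2|/forallPn[j]] := boolP [forall j, v j < 2]%N; last first.
  by rewrite -leqNgt => vj; rewrite [LHS](tens_eq0 _ vj) [RHS](tens_eq0 _ vj).
apply: (tens_ind (f := tens_gen \o tens_emb) (g := idfun)) => x /=.
rewrite tlift_pure.
apply: (multilinear_eq (e := fun j => gen (v j))
  (F := fun x => tens_gen (emb_prod x))) => //.
- by move=> y i a u u'; rewrite emb_prod_multilinear linearP.
- exact: pure_multilinear.
move=> s; transitivity (tens_gen (\prod_j mon (s j))); last exact: lift_mon.
by congr (tens_gen _); apply: eq_bigr => j _; rewrite emb_gen.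
Qed.

Lemma tens_genK : (forall j, v j < 2)%N -> cancel tens_gen tens_emb.
Proof.
move=> v2; apply: (linear_eq_spans (f := tens_emb \o tens_gen) (g := idfun) mon_spans).
move=> t; rewrite /= lift_mon tlift_pure; apply: eq_bigr => j _; exact: emb_gen.
Qed.

End MultiDegree.

(** A face acts on the [i]-th factor by its differential, which becomes the
    multiplication by [L i] in [B], and leaves the other factors unchanged. *)
Lemma tens_emb_face p q (v : midx m p) (u : midx m q) i t :
    deg_at u i = 0%N -> (forall j, deg_at v j = deg_at u j + (j == i))%N ->
  tens_emb (deg_at u) (tface C v u i t) = L i * tens_emb (deg_at v) t.
Proof.
move=> ui vu; move: t; apply: tens_ind_mul => x.
rewrite tmap_pure /= !tlift_pure /emb_prod !(bigD1 (P := predT) i) //= eqxx mulrA.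
have emb_cdiff a b y : b = 0%N -> a = 1%N ->
    emb i b (cdiff (C i) a b y) = L i * emb i a y.
  by move=> b0 a1; move: y; rewrite b0 a1 => y; rewrite cdiffS emb_dif.
have emb_cid j a b y : a = b -> emb j b (Defs.cid (C j) a b y) = emb j a y.
  by move=> e; case: _ / e; rewrite (cid_id (erefl _)).
congr (_ * _); first by rewrite emb_cdiff // vu eqxx ui.
by apply: eq_bigr => j /negbTE ji; rewrite ji emb_cid // vu ji addn0.
Qed.

Section Indicator.
Variable p : nat.

Fact indicator_bound (T : ksub m p) j : ((j \in val T) < p.+1)%N.
Proof.
case: (boolP (j \in val T)) => // jT; rewrite ltnS -(eqP (valP T)).
by apply/card_gt0P; exists j.
Qed.

Definition indicator_fun (T : ksub m p) : {ffun 'I_m -> 'I_p.+1} :=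
  [ffun j => Ordinal (indicator_bound T j)].

Fact indicator_sum T : (\sum_i (indicator_fun T i : nat))%N == p.
Proof.
rewrite -[X in _ == X](eqP (valP T)) -sum1_card [X in _ == X]big_mkcond /=.
by apply/eqP/eq_bigr => j _; rewrite ffunE /=; case: ifP.
Qed.

Definition indicator T : midx m p := exist _ (indicator_fun T) (indicator_sum T).

Lemma deg_indicator T j : deg_at (indicator T) j = (j \in val T).
Proof. by rewrite /deg_at ffunE. Qed.

Definition ones (v : midx m p) : {set 'I_m} := [set j | deg_at v j == 1%N].

Lemma midx_inj (u v : midx m p) : deg_at u =1 deg_at v -> u = v.
Proof. by move=> uv; apply/val_inj/ffunP => j; apply/val_inj/uv. Qed.

Lemma ones_indicator T : ones (indicator T) = val T.
Proof. by apply/setP => j; rewrite inE deg_indicator eqb1. Qed.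

Lemma indicator_ones v : (forall j, deg_at v j < 2)%N ->
  exists2 T : ksub m p, val T = ones v & indicator T = v.
Proof.
move=> v2.
have vE j : deg_at v j = (j \in ones v).
  by rewrite inE; move: (v2 j); case: (deg_at v j) => [|[]].
have cT : #|ones v| == p.
  apply/eqP; rewrite -[RHS](eqP (valP v)) -sum1_card big_mkcond /=.
  by apply: eq_bigr => j _; rewrite -[RHS]/(deg_at v j) vE; case: ifP.
exists (exist (fun S : {set 'I_m} => #|S| == p) _ cT) => //; apply: midx_inj => j.
by rewrite deg_indicator vE.
Qed.

End Indicator.

Local Notation Z := (tensor_complex C).
Local Notation Kos := (koszul hB L w).

Section Iso.
Variable p : nat.

Definition tensor_to_koszul (c : Z p) : Kos p :=
  [ffun T : ksub m p => tens_emb (deg_at (indicator T)) (c (indicator T))].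

Fact tensor_to_koszul_linear : linear tensor_to_koszul.
Proof. by move=> a x y; apply/ffunP => T; rewrite !ffunE linearP. Qed.
HB.instance Definition _ := GRing.isLinear.Build R (Z p) (Kos p) _
  tensor_to_koszul tensor_to_koszul_linear.

Definition koszul_to_tensor (y : Kos p) : Z p :=
  [ffun v : midx m p => tens_gen (deg_at v) (kcoef y (ones v))].

Lemma kcoef_val (y : Kos p) (T : ksub m p) : kcoef y (val T) = y T.
Proof. by rewrite /kcoef valK. Qed.

Lemma tensor_to_koszulK : cancel tensor_to_koszul koszul_to_tensor.
Proof.
move=> c; apply/ffunP => v; rewrite ffunE.
have [/forallP v2|/forallPn[j]] := boolP [forall j, deg_at v j < 2]%N; last first.
  by rewrite -leqNgt => vj; rewrite [LHS](tens_eq0 _ vj) [RHS](tens_eq0 _ vj).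
have [T Tv <-] := indicator_ones v2.
by rewrite ones_indicator kcoef_val ffunE tens_embK.
Qed.

Lemma koszul_to_tensorK : cancel koszul_to_tensor tensor_to_koszul.
Proof.
move=> y; apply/ffunP => T; rewrite !ffunE ones_indicator kcoef_val.
by rewrite tens_genK // => j; rewrite deg_indicator; case: (_ \in _).
Qed.

End Iso.

(** Along the coordinate of [T], the face in direction [i] can only come from the
    multi-index that exceeds the indicator of [T] by one at [i].  If [i] is in [T]
    this multi-index takes the value 2, and the corresponding summand is zero;
    otherwise it is the indicator of [i |: T].  The number of [j < i] in [T]
    governs the sign on both sides. *)
Lemma tensor_to_koszul_dif p (c : Z p.+1) :
  tensor_to_koszul (tdif_fun c) = kdif_fun L (tensor_to_koszul c).
Proof.
apply/ffunP => T; rewrite !ffunE linear_sum; set u := indicator T.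
under eq_bigr do rewrite linear_sum.
rewrite exchange_big [RHS]big_mkcond; apply: eq_bigr => i _.
have uE j : deg_at u j = (j \in val T) by apply: deg_indicator.
have off_face v : ~ (forall j, deg_at v j = deg_at u j + (j == i))%N ->
    tface C v u i (c v) = 0.
  move=> nvu; have [/forallP vu|/forallPn[j]] :=
    boolP [forall j, deg_at v j == deg_at u j + (j == i)]%N; last exact: tface0.
  by case: nvu => j; apply/eqP.
have [iT|iT] := boolP (i \in val T).
  rewrite big1 // => v _; rewrite linearZZ.
  have [vu|/off_face ->] := pselect (forall j, deg_at v j = deg_at u j + (j == i))%N;
    last by rewrite linear0 scaler0.
  by rewrite (@tens_eq0 _ i (c v)) ?linear0 ?scaler0 // vu uE iT eqxx.
have cS : #|i |: val T| == p.+1 by rewrite cardsU1 iT (eqP (valP T)).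
pose S : ksub m p.+1 := exist (fun S : {set 'I_m} => #|S| == p.+1) _ cS.
have Su j : deg_at (indicator S) j = (deg_at u j + (j == i))%N.
  rewrite uE deg_indicator in_setU1.
  by have [->|] := eqVneq j i; rewrite ?(negbTE iT) ?addn0.
rewrite (big_only1 (indicator S)) // => [|v vS _]; last first.
  rewrite linearZZ off_face ?linear0 ?scaler0 // => vu; case/eqP: vS.
  by apply: midx_inj => j; rewrite vu Su.
rewrite linearZZ tens_emb_face //; last by rewrite uE (negbTE iT).
rewrite -[i |: val T]/(val S) kcoef_val ffunE -mulrA.
have -> : (\sum_(j < m | (j < i)%N) deg_at u j)%N = #|[set j in val T | (j < i)%N]|.
  rewrite -sum1_card big_mkcond [RHS]big_mkcond /=; apply: eq_bigr => j _.
  by rewrite inE uE; case: (j \in _); case: (j < i)%N.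
by rewrite /ksgn -signr_odd scaler_sign -[in RHS]signr_odd mulr_sign.
Qed.

Section Homogeneous.
Hypothesis hB0 : forall u, hB u 0.
Hypothesis hBD : forall u a b, hB u a -> hB u b -> hB u (a + b).
Hypothesis hB1 : hB 0 1.
Hypothesis hBM : forall u v a b, hB u a -> hB v b -> hB (u + v) (a * b).
Hypothesis hR1 : hR 0 1.
Hypothesis emb_hom : forall j p u x,
  ghom u x -> hB (u - w j *+ p) (emb j p x).
Hypothesis gen_hom : forall j p u a (t : K j),
  hR u a -> ghom (u + wt t + w j *+ p) (a *: gen p t).
Hypothesis hB_expand : forall u b, hB u b ->
  exists r (a : 'I_r -> R) (t : 'I_r -> forall j, K j),
    (forall l, hR (u - \sum_j wt (t l j)) (a l)) /\
    b = \sum_l a l *: \prod_j mon (t l j).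
(* The factor that absorbs scalars in a pure tensor. *)
Variable i0 : 'I_m.

Lemma tens_emb_hom v u (t : gtens (fun j => C j (v j))) :
  ghom u t -> hB (u - \sum_j w j *+ v j) (tens_emb v t).
Proof.
case=> r [x] [W] [xW Wu ->]; rewrite linear_sum.
apply: (big_ind (hB _)) => [||l _]; [exact: hB0 | exact: hBD |].
rewrite /= tlift_pure -(Wu l) -sumrB.
by apply: (big_ind2 hB) => // [*|j _]; [apply: hBM | apply: emb_hom].
Qed.

Lemma pure_scale_at (M : 'I_m -> lmodType R) (x : forall j, M j) a :
  pure (fun j => (if j == i0 then a else 1) *: x j) = a *: pure x.
Proof.
rewrite -[in RHS](dfwith_id x i0) -[RHS](linearZZ (pure_at x (i := i0))) /pure_at.
congr pure; apply: functional_extensionality_dep => j.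
case: (eqVneq j i0) => [->|ji]; first by rewrite dfwith_in.
by rewrite scale1r dfwith_out // eq_sym.
Qed.

(** The coefficients of [b] on the basis are homogeneous, in general of nonzero degree:
    each of them is put in the [i0]-th factor of the pure tensor. *)
Lemma tens_gen_hom v u b : hB (u - \sum_j w j *+ v j) b ->
  ghom u (tens_gen v b : gtens (fun j => C j (v j))).
Proof.
case/hB_expand => r [a] [t] [at_hom ->].
exists r, (fun l j => (if j == i0 then a l else 1) *: gen (v j) (t l j)).
exists (fun l j => (if j == i0 then u - \sum_j w j *+ v j - \sum_j wt (t l j)
                    else 0) + wt (t l j) + w j *+ v j); split.
- by move=> l j; case: eqP => _; apply: gen_hom.
- move=> l; rewrite !big_split /= -big_mkcond big_pred1_eq.
  by rewrite !subrK.
by rewrite linear_sum; apply: eq_bigr => l _; rewrite pure_scale_at linearZ /= lift_mon.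
Qed.

Lemma tensor_to_koszul_hom p u (c : Z p) : ghom u c <-> ghom u (tensor_to_koszul c).
Proof.
split=> uc; hnf; last move=> v; first move=> T.
  rewrite ffunE; have := tens_emb_hom (uc (indicator T)).
  rewrite (eq_bigr (fun j => if j \in val T then w j else 0)) -?big_mkcond // => j _.
  by rewrite deg_indicator; case: (_ \in _).
have [/forallP v2|/forallPn[j]] := boolP [forall j, deg_at v j < 2]%N; last first.
  rewrite -leqNgt => vj; rewrite (tens_eq0 (c v) vj).
  exists 0%N, (fun=> fun=> 0), (fun=> fun=> 0).
  by split=> [[]|[]|] //; rewrite big_ord0.
have [T _ <-] := indicator_ones v2.
rewrite -[c _](tens_embK); apply: tens_gen_hom.
have := uc T; rewrite /= ffunE big_mkcond.
rewrite (eq_bigr (fun j => w j *+ deg_at (indicator T) j)) // => j _.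
by rewrite deg_indicator; case: (_ \in _).
Qed.

(** The hypotheses on [emb] say that [C j], once its generators are identified with
    elements of [B], is the Koszul complex of the single element [L j]. *)
Lemma tensor_koszul_iso : complex_iso Z Kos.
Proof.
exists (fun p => tensor_to_koszul (p := p)); split => [p|p x|p u x].
- by exists (@koszul_to_tensor p); [apply: tensor_to_koszulK | apply: koszul_to_tensorK].
- exact: tensor_to_koszul_dif.
exact (tensor_to_koszul_hom u x).
Qed.

End Homogeneous.
End TensorKoszul.

(** * The isomorphism *)

Theorem proposition8 (k : fieldType) (n : nat)
    (f g : 'I_n.+1 -> {mpoly k[n.+1]}) (d : 'I_n.+1 -> nat)
    (hf : forall i, f i \is (d i).-homog)
    (hg : forall i, g i \is (d i).-homog)
    (hreg : forall i, regular_seq [:: f i; g i]) :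
  complex_iso
    (tensor_complex (fun i => approx_complex i (f i) (g i) (d i)))
    (koszul_L f g d).
Proof.
pose coord i := boolp.cid (regular_cycle_coord (hreg i)).
pose c i := projT1 (coord i).
have c1 i : c i (koszul_cycle (f i) (g i)) = 1 by have [] := projT2 (coord i).
have cK i z : z = (c i z : {mpoly k[n.+1]}) *: koszul_cycle (f i) (g i).
  by have [_] := projT2 (coord i); apply.
have f0 i : f i != 0 := regular_seq_head_neq0 (hreg i).
pose C i : complex {mpoly k[n.+1]} (mgrade n.+1) := approx_complex i (f i) (g i) (d i).
pose gen j p (t : 'X_{1..2}) : C j p := zgen j (f j) (g j) (d j) p t.
pose emb j p : {linear C j p -> {mpoly {mpoly k[n.+1]}[n.+1 + n.+1]}} :=
  zemb j (d j) (c j) p.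
rewrite /koszul_L.
refine (@tensor_koszul_iso _ _ _ n.+1 (@Ahom k n.+1 n.+1) (Phom (@Bdeg n.+1))
  (Lpoly f g) (fun i => tdeg n.+1 (d i) + vdeg i) C (fun=> 'X_{1..2})
  (fun j t => 'X_[t] \mPo block_vars {mpoly k[n.+1]} j)
  (fun j t => \sum_h vdeg j *+ t h) gen emb (@block_lift _ n.+1)
  _ _ _ _ _ _ _ _ _ _ _ _ _ _ ord0).
- by move=> j p x; apply: zobj_big.
- by move=> j p; apply: (zgen_spans (cK j)).
- by move=> j p t; apply: zemb_gen.
- by move=> j x; apply: (zemb_dif (cK j)).
- exact: block_products_span.
- exact: block_liftE.
- exact: Phom0.
- exact: PhomD.
- exact: Phom1.
- exact: PhomM.
- by apply: (@Ahom_dhomog _ _ _ 0); apply: dhomog1.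
- by move=> j p u x; apply: (zemb_hom (hf j) (cK j)).
- by move=> j p u a t; apply: zgen_hom.
exact: Phom_block_expand.
Qed.
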